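(* Let $f,g\colon\mathcal H\to(-\infty,+\infty]$ and the nonempty closed convex set $S\subseteq\mathcal H$ satisfy Assumptions 1 and 2' stated in the context, and let $(x_n)_{n\in\mathbb N}$ be a sequence generated by the enhanced extrapolated proximal subgradient algorithm described in the context. Suppose that the set $\{x\in S:\frac{f(x)}{g(x)}\le\frac{f(x_0)}{g(x_0)}\}$ is bounded. Then the following hold: (i) For all $n\in\mathbb N$, $x_n\in S\cap\operatorname{dom}f$, and the sequence $$F_n:=\frac{f(x_n)}{g(x_n)}+\left(\frac{\ell\overline\kappa^2}{2m}+\frac{\overline\mu}{2\sqrt{mM}}\right)\|x_n-x_{n-1}\|^2$$ is nonincreasing and convergent. Consequently, the sequence $\left(\frac{f(x_n)}{g(x_n)}\right)_{n\in\mathbb N}$ is convergent. (ii) The sequence $(x_n)_{n\in\mathbb N}$ is bounded and asymptotically regular (i.e. $\|x_{n+1}-x_n\|\to0$). In particular, $\sum_{n=0}^{+\infty}\|x_{n+1}-x_n\|^2<+\infty$. (iii) If $\liminf_{n\to+\infty}\tau_n=\overline\tau>0$, then, for every cluster point $\overline x$ of $(x_n)_{n\in\mathbb N}$, it holds that $\overline x\in S\cap\operatorname{dom}f$, $\lim_{n\to+\infty}\frac{f(x_n)}{g(x_n)}=\frac{f(\overline x)}{g(\overline x)}$, and $$\frac{f(\overline x)}{g(\overline x)}\bigcup_{i\in I_0(\overline x)}\{\nabla g_i(\overline x)\}\subseteq\partial_L(f+\iota_S)(\overline x).$$ In addition, if $f$ is weakly convex on $S$, then $\overline x$ is a strong lifted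 stationary point of $\min_{x\in S}\frac{f(x)}{g(x)}$, that is, $f(\overline x)\,\partial_Lg(\overline x)\subseteq g(\overline x)\,\partial_L(f+\iota_S)(\overline x)$.
   Context: $\mathcal H$ is a finite-dimensional real Hilbert space with inner product $\langle\cdot,\cdot\rangle$ and norm $\|\cdot\|$; $\mathbb N=\{0,1,2,\dots\}$; $\mathbb R_+=[0,+\infty)$; $\mathbb R_{++}=(0,+\infty)$. $\operatorname{dom}h=\{x:h(x)<+\infty\}$. $\iota_S$ is the indicator function of $S$ ($0$ on $S$, $+\infty$ off $S$). Subdifferentials: for $h$ finite at $x$, the Fréchet subdifferential is $\widehat\partial h(x)=\{u:\liminf_{z\to x}\frac{h(z)-h(x)-\langle u,z-x\rangle}{\|z-x\|}\ge0\}$, and the limiting subdifferential $\partial_L h(x)$ is the set of all $u$ for which there exist $x_n\to x$ with $h(x_n)\to h(x)$ and $u_n\in\widehat\partial h(x_n)$ with $u_n\to u$; both are $\varnothing$ where $h$ is not finite. $h$ is weakly convex on $S$ if there is $\rho\ge0$ such that $h+\iota_S+\frac\rho2\|\cdot\|^2$ is convex. Assumption 1: $f=f^{\mathfrak s}+f^{\mathfrak n}$, where $f^{\mathfrak s}\colon\mathcal H\to\mathbb R$ is a continuously differentiable convex function whose gradient is Lipschitz continuous with modulus $\ell$ on $\mathcal H$, $f^{\mathfrak n}\colon\mathcal H\to(-\infty,+\infty]$ is proper lower semicontinuous, $S\cap\operatorname{dom}f\ne\varnothing$, and $f(x)\ge0$ for all $x\in S\cap\operatorname{dom}f$. Assumption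 2': $g\colon\mathcal H\to(-\infty,+\infty]$ is proper lower semicontinuous, finite and positive on $S$, and $g(x)=\max\{g_i(x):1\le i\le p\}$, where each $g_i$ is continuously differentiable on an open set containing $S$ and weakly convex on $S$ with modulus $\beta\in\mathbb R_+$ (i.e. $g_i+\iota_S+\frac\beta2\|\cdot\|^2$ is convex for each $i$); and (BC) holds: there exist $m,M\in\mathbb R_{++}$ with $m\le g(x)\le M$ for all $x\in S\cap\operatorname{dom}f$. For $\varepsilon\ge0$, $I_\varepsilon(x)=\{i\in\{1,\dots,p\}:g_i(x)\ge g(x)-\varepsilon\}$. Enhanced extrapolated proximal subgradient algorithm. Step 1: choose $x_{-1}=x_0\in S\cap\operatorname{dom}f$. Let $\delta,\varepsilon\in\mathbb R_{++}$, let $\zeta\in\mathbb R_{++}$ satisfy $1-\sqrt\beta\zeta>0$, and let $$\overline\mu\in\left[0,\frac{\delta(1-\sqrt\beta\zeta)\sqrt{mM}}{2M}\right),\qquad \overline\kappa\in\left[0,\sqrt{\frac{m\delta(1-\sqrt\beta\zeta)}{\ell M}-\frac{2m\overline\mu}{\ell\sqrt{mM}}}\right)$$ (if $\ell=0$, the upper bound for $\overline\kappa$ is read as $+\infty$). For $n=0,1,2,\dots$ do Steps 2 and 3. Step 2: set $\theta_n=\frac{f(x_n)}{g(x_n)}$ and choose $\tau_n\in\mathbb R$ with $0<\tau_n\le1/\max\{\sqrt\beta\theta_n/\zeta,\delta\}$; let $u_n=x_n+\kappa_n(x_n-x_{n-1})$ with $\kappa_n\in[0,\overline\kappa]$ and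 $v_n=x_n+\mu_n(x_n-x_{n-1})$ with $\mu_n\in[0,\overline\mu\tau_n]$. For each $i_n\in I_\varepsilon(x_n)$, find $$w_n^{i_n}\in\operatorname*{argmin}_{x\in S}\left(f^{\mathfrak n}(x)+f^{\mathfrak s}(u_n)+\langle\nabla f^{\mathfrak s}(u_n),x-u_n\rangle+\frac1{2\tau_n}\|x-v_n-\tau_n\theta_n\nabla g_{i_n}(x_n)\|^2+\frac\ell2\|x-u_n\|^2\right).$$ Step 3: set $x_{n+1}:=w_n^{\hat i_n}$, where $$\hat i_n\in\operatorname*{argmin}_{i_n\in I_\varepsilon(x_n)}\left(f(w_n^{i_n})-\theta_ng(w_n^{i_n})+\frac12\left(\frac{1-\sqrt\beta\zeta}{\tau_n}-\frac{M\mu_n}{\sqrt{mM}\,\tau_n}\right)\|w_n^{i_n}-x_n\|^2\right).$$ The sequence is assumed to be infinite (the algorithm is run without termination). *)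

(* Defs.v *)
From HB Require Import structures.
From mathcomp Require Import all_boot all_order all_algebra.
From mathcomp Require Import all_classical all_reals all_analysis.

Set Implicit Arguments.
Unset Strict Implicit.
Unset Printing Implicit Defensive.

Import Order.TTheory GRing.Theory Num.Theory.
Import numFieldNormedType.Exports.

Local Open Scope classical_set_scope.
Local Open Scope ring_scope.

Definition finite_dimensional (R : realType) (V : normedModType R) : Prop :=
  exists (n : nat) (e : 'I_n -> V),
    forall v : V, exists c : 'I_n -> R, v = \sum_(i < n) c i *: e i.

(* Completeness is not required: it follows from finite dimension. *)
Record finite_dimensional_hilbert (R : realType) (V : normedModType R)
    (dot : {dot V for @idfun R}) : Prop := {
  hilbert_norm : forall v : V, `|v| ^+ 2 = dot v v;
  hilbert_dim : finite_dimensional V }.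

Section ExtendedFunctions.
Context (R : realType) (V : normedModType R).
Implicit Types (h : V -> \bar R) (S : set V).

Definition edom h : set V := [set x | (h x < +oo)%E].

Definition proper_function h : Prop :=
  (forall x, (-oo < h x)%E) /\ (edom h !=set0).

Definition indicator S : V -> \bar R := fun x => if x \in S then 0%E else +oo%E.

(* [0 * +oo = 0] in [\bar R], so the cases [t = 0] and [t = 1] are harmless. *)
Definition econvex h : Prop :=
  forall (x y : V) (t : R), 0 <= t <= 1 ->
    (h (t *: x + (1 - t) *: y)%R <= t%:E * h x + (1 - t)%:E * h y)%E.

Definition weakly_convex_modulus (rho : R) S h : Prop :=
  econvex (fun x => h x + indicator S x + (rho / 2 * `|x| ^+ 2)%:E)%E.

Definition weakly_convex S h : Prop :=
  exists2 rho : R, 0 <= rho & weakly_convex_modulus rho S h.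

Definition argmin (T : Type) (A : set T) (phi : T -> \bar R) : set T :=
  [set a | A a /\ forall b, A b -> (phi a <= phi b)%E].

(* The quotient is taken in [\bar R]: where [g] is finite and positive, it is
   [+oo] as soon as [f] is. *)
Definition fractional_objective (f g : V -> \bar R) : V -> \bar R := fun x => (f x / g x)%E.

End ExtendedFunctions.

Section Subdifferentials.
Context (R : realType) (V : normedModType R) (dot : {dot V for @idfun R}).
Implicit Types (h : V -> \bar R) (S : set V).

(* The Riesz representative of the differential; it is only meaningful where
   [F] is differentiable. *)
Definition gradient (F : V -> R^o) (x : V) : V :=
  xget 0 [set u | forall v, 'd F x v = dot u v].

Definition continuously_differentiable_on (U : set V) (F : V -> R^o) : Prop :=
  forall x, U x -> differentiable F x /\ {for x, continuous (gradient F)}.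

Definition frechet_subdifferential h (x : V) : set V :=
  [set u | h x \is a fin_num /\
    (0 <= limf_einf (fun z => (h z - h x - (dot u (z - x))%:E)
                              * (`|z - x|^-1)%:E) x^')%E].

Definition limiting_subdifferential h (x : V) : set V :=
  [set u | h x \is a fin_num /\
    exists (y v : nat -> V),
      [/\ y @ \oo --> x,
          (h \o y) @ \oo --> h x,
          forall n, frechet_subdifferential h (y n) (v n)
        & v @ \oo --> u]].

(* To be used at points of [S] where [f] is finite. *)
Definition strong_lifted_stationary (f g : V -> \bar R) S (x : V) : Prop :=
  [set fine (f x) *: u | u in limiting_subdifferential g x] `<=`
  [set fine (g x) *: u |
     u in limiting_subdifferential (fun y => f y + indicator S y)%E x].

End Subdifferentials.

Section FractionalProgram.
Context (R : realType) (V : normedModType R) (dot : {dot V for @idfun R}).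

Record numerator_assumption (S : set V) (f : V -> \bar R) (fs : V -> R^o)
    (fn : V -> \bar R) (l : R) : Prop := {
  num_sum : forall x, f x = ((fs x)%:E + fn x)%E;
  num_smooth : continuously_differentiable_on dot [set: V] fs;
  num_smooth_convex : convex_function [set: V] fs;
  num_modulus_ge0 : 0 <= l;
  num_grad_lipschitz : l.-lipschitz (gradient dot fs);
  num_nonsmooth_proper : proper_function fn;
  num_nonsmooth_lsc : lower_semicontinuous fn;
  num_feasible : S `&` edom f !=set0;
  num_ge0 : forall x, (S `&` edom f) x -> (0 <= f x)%E }.

(* The [gi i] are extended-valued and their maximum is [g] on the whole space,
   not only on [S]. *)
Record denominator_assumption (S : set V) (f g : V -> \bar R) (p : nat)
    (gi : 'I_p -> V -> \bar R) (beta m M : R) : Prop := {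
  den_proper : proper_function g;
  den_lsc : lower_semicontinuous g;
  den_finite_pos : forall x, S x -> (0 < g x < +oo)%E;
  den_pieces_ninfty : forall i x, (-oo < gi i x)%E;
  den_max : forall x, g x = \big[maxe/-oo%E]_(i < p) gi i x;
  den_pieces_smooth : forall i, exists U : set V,
    [/\ open U, S `<=` U, forall x, U x -> gi i x \is a fin_num
      & continuously_differentiable_on dot U (fine \o gi i)];
  den_modulus_ge0 : 0 <= beta;
  den_pieces_weakly_convex : forall i, weakly_convex_modulus beta S (gi i);
  den_m_gt0 : 0 < m;
  den_M_gt0 : 0 < M;
  den_bounds : forall x, (S `&` edom f) x -> (m%:E <= g x <= M%:E)%E }.

Definition active_set (p : nat) (g : V -> \bar R) (gi : 'I_p -> V -> \bar R)
    (eps : R) (x : V) : set 'I_p :=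
  [set i | (g x - eps%:E <= gi i x)%E].

Definition prox_objective (fs : V -> R^o) (fn : V -> \bar R) (l tau : R)
    (u c : V) : V -> \bar R := fun y =>
  (fn y + (fs u + dot (gradient dot fs u) (y - u)
           + (2 * tau)^-1 * `|y - c| ^+ 2 + l / 2 * `|y - u| ^+ 2)%:E)%E.

(* The sequence is indexed by [nat]; since [0.-1 = 0], the term [x n.-1] stands
   for x_{n-1} with the convention x_{-1} = x_0. *)
Record extrapolated_proximal_subgradient (S : set V) (f g : V -> \bar R)
    (fs : V -> R^o) (fn : V -> \bar R) (p : nat) (gi : 'I_p -> V -> \bar R)
    (l beta m M delta eps zeta mubar kappabar : R) (tau kappa mu : nat -> R)
    (w : nat -> 'I_p -> V) (ihat : nat -> 'I_p) (x : nat -> V) : Prop := {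
  alg_start : (S `&` edom f) (x 0%N);
  alg_delta : 0 < delta;
  alg_eps : 0 < eps;
  alg_zeta : 0 < zeta;
  alg_zeta_beta : 0 < 1 - Num.sqrt beta * zeta;
  alg_mubar : 0 <= mubar <
    delta * (1 - Num.sqrt beta * zeta) * Num.sqrt (m * M) / (2 * M);
  alg_kappabar_ge0 : 0 <= kappabar;
  alg_kappabar_lt : 0 < l -> kappabar <
    Num.sqrt (m * delta * (1 - Num.sqrt beta * zeta) / (l * M)
              - 2 * m * mubar / (l * Num.sqrt (m * M)));
  alg_tau : forall n, 0 < tau n <=
    1 / Num.max (Num.sqrt beta * fine (fractional_objective f g (x n)) / zeta) delta;
  alg_kappa : forall n, 0 <= kappa n <= kappabar;
  alg_mu : forall n, 0 <= mu n <= mubar * tau n;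
  alg_subproblem : forall n i, active_set g gi eps (x n) i ->
    let theta := fine (fractional_objective f g (x n)) in
    let u := x n + kappa n *: (x n - x n.-1) in
    let v := x n + mu n *: (x n - x n.-1) in
    argmin S
      (prox_objective fs fn l (tau n) u
         (v + (tau n * theta) *: gradient dot (fine \o gi i) (x n)))
      (w n i);
  alg_selection : forall n,
    let theta := fine (fractional_objective f g (x n)) in
    argmin (active_set g gi eps (x n))
      (fun i => f (w n i) - theta%:E * g (w n i)
         + (2^-1 * ((1 - Num.sqrt beta * zeta) / tau n
                    - M * mu n / (Num.sqrt (m * M) * tau n))
            * `|w n i - x n| ^+ 2)%:E)%E
      (ihat n);
  alg_next : forall n, x n.+1 = w n (ihat n) }.

End FractionalProgram.

(* Main.v *)
(** The choice [y = x n] in the subproblem, the descent lemma for [fs], the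
    gradient inequalities for [fs] and the pieces [gi], and Young's inequality
    for the inertial term show that the merit function [F] decreases by at
    least a fixed multiple of [`|x n.+1 - x n| ^+ 2].

    At a cluster point [xbar], fix a piece [i] active at [xbar].  Along the
    subsequence it is [eps]-active, so the subproblem for [i] may be compared
    with an arbitrary competitor [z]; since the selection rule makes
    [x n.+1] at least as good as the solution of that subproblem, the limit
    involves no convergence of [w n i] and reads
      [f z >= a * g xbar + a * dot v (z - xbar) - K * `|z - xbar| ^+ 2]
    with [a] the limit of the ratios and [v] the gradient of [gi] at [xbar].
    Taking [z = xbar] and using lower semicontinuity gives
    [f xbar = a * g xbar], and then [a *: v] is a Frechet subgradient of
    [f + indicator S].  Being valid for all active pieces, the inequality
    extends to subgradients [u] of [g], because [dot u d] is at most the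
    maximum of the [dot v d]. *)
Require Import Defs.
From HB Require Import structures.
From mathcomp Require Import all_boot all_order all_algebra.
From mathcomp Require Import all_classical all_reals all_analysis.
From mathcomp Require Import ring lra.
Import Order.TTheory GRing.Theory Num.Theory.
Import numFieldNormedType.Exports.
Local Open Scope classical_set_scope.
Local Open Scope ring_scope.

Set Implicit Arguments.
Unset Strict Implicit.
Unset Printing Implicit Defensive.

(** * Inner product inequalities, Riesz representation and gradients *)

Section InnerProduct.
Context (R : realType) (V : normedModType R) (dot : {dot V for @idfun R}).
Context (hV : finite_dimensional_hilbert dot).
Implicit Types (u v z : V).

Lemma dotC u v : dot u v = dot v u.
Proof. by rewrite hermC expr0 mul1r. Qed.

Lemma dotDl u v z : dot (u + v) z = dot u z + dot v z.
Proof. exact: linearDl. Qed.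

Lemma dotZl (a : R) u z : dot (a *: u) z = a * dot u z.
Proof. exact: linearZl_LR. Qed.

Lemma dotNr u z : dot u (- z) = - dot u z.
Proof. exact: linearNr. Qed.

Lemma dotZr (a : R) u z : dot u (a *: z) = a * dot u z.
Proof. by rewrite dotC dotZl dotC. Qed.

Lemma dotBl u v z : dot (u - v) z = dot u z - dot v z.
Proof. exact: linearBl. Qed.

Lemma dotDr u v z : dot z (u + v) = dot z u + dot z v.
Proof. exact: linearDr. Qed.

Lemma dotBr u v z : dot z (u - v) = dot z u - dot z v.
Proof. exact: linearBr. Qed.

Lemma normD_sqr u v : `|u + v| ^+ 2 = `|u| ^+ 2 + 2 * dot u v + `|v| ^+ 2.
Proof.
rewrite !(hilbert_norm hV) dotDl !dotDr (dotC v u); ring.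
Qed.

Lemma normB_sqr u v : `|u - v| ^+ 2 = `|u| ^+ 2 - 2 * dot u v + `|v| ^+ 2.
Proof. by rewrite normD_sqr normrN dotNr mulrN. Qed.

Lemma dot_young (c : R) u v : 0 < c ->
  2 * dot u v <= c * `|u| ^+ 2 + `|v| ^+ 2 / c.
Proof.
move=> c0; have := sqr_ge0 `|c *: u - v|.
rewrite normB_sqr normrZ dotZl exprMn (gtr0_norm c0) => h.
rewrite -(ler_pM2l c0) mulrDr [c * (`|v| ^+ 2 / c)]mulrC divfK ?gt_eqF//; nra.
Qed.

Lemma dot_cauchy u v : dot u v <= `|u| * `|v|.
Proof.
have [->|v0] := eqVneq v 0; first by rewrite linear0r normr0 mulr0.
have [->|u0] := eqVneq u 0; first by rewrite linear0l normr0 mul0r.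
(* This weight balances the two terms of Young's inequality, whose right side becomes twice the
   product of the norms. *)
rewrite -(@ler_pM2l _ 2)//; apply: le_trans (@dot_young (`|v| / `|u|) u v _) _.
  by rewrite divr_gt0 ?normr_gt0.
rewrite le_eqVlt; apply/orP; left; apply/eqP; field.
by rewrite !normr_eq0 v0 u0.
Qed.

Lemma dot_cvg (T : Type) (F : set_system T) (FF : Filter F) (a b : T -> V) u v :
  a @ F --> u -> b @ F --> v -> (fun t => dot (a t) (b t)) @ F --> dot u v.
Proof.
move=> au bv.
(* Polarization reduces joint continuity of [dot] to continuity of the norm. *)
have polar x y : dot x y = 4^-1 * (`|x + y| ^+ 2 - `|x - y| ^+ 2).
  by rewrite normD_sqr normB_sqr; field.
rewrite polar; under eq_cvg do rewrite polar.
apply: cvgM; first exact: cvg_cst.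
by apply: cvgB; rewrite /GRing.exp /=; apply: cvgM; apply: cvg_norm;
  do ?apply: cvgB; do ?apply: cvgD.
Qed.

(* The second conjunct says that [u] lies in the span of [s]. *)
Lemma riesz_seq (s : seq V) (L : {linear V -> R^o}) :
  exists u, {in s, forall v, L v = dot u v} /\
    forall K : {linear V -> R^o}, {in s, forall v, K v = 0} -> K u = 0.
Proof.
elim: s L => [|e s IHs] L.
  by exists 0; split=> // K _; rewrite linear0.
have [u [Lu u_span]] := IHs L.
(* Gram-Schmidt step: [q] is the orthogonal projection of [e] on the span of [s]. If [e = q], then
   [e] lies in that span and [u] already represents [L] on it. *)
have [q [eE q_span]] := IHs (dot e).
have [e0|qe0] := eqVneq (e - q) 0.
  exists u; split=> [v|K Ks]; last first.
    by apply: u_span => z zs; apply: Ks; rewrite inE zs orbT.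
  rewrite inE => /predU1P[->|]; last exact: Lu.
  have := q_span (L \- dot u); rewrite /= (subr0_eq e0).
  move=> h; apply/eqP; rewrite -subr_eq0; apply/eqP; apply: h => z zs.
  by rewrite Lu// subrr.
have perp v : v \in s -> dot (e - q) v = 0.
  by move=> vs; rewrite dotBl eE// subrr.
have perpq : dot (e - q) q = 0.
  by apply: (q_span (dot (e - q))) => v /perp.
have d0 : dot (e - q) (e - q) != 0 by rewrite gt_eqF// neq0_dnorm_gt0.
(* As [e - q] is orthogonal to [s], adding a multiple of it keeps the values on [s]; the coefficient
   corrects the value at [e]. *)
exists (u + ((L e - dot u e) / dot (e - q) (e - q)) *: (e - q)).
split=> [v|K Ks].
  rewrite inE dotDl dotZl => /predU1P[->|vs]; last first.
    by rewrite (perp v vs) mulr0 addr0 Lu.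
  have -> : dot (e - q) e = dot (e - q) (e - q) by rewrite dotBr perpq subr0.
  by rewrite divfK// addrC subrK.
have Ks' v : v \in s -> K v = 0 by move=> vs; apply: Ks; rewrite inE vs orbT.
rewrite linearD linearZ [K (e - q)]linearB /= u_span// q_span// Ks ?mem_head//.
by rewrite subrr scaler0 addr0.
Qed.

Lemma riesz (L : {linear V -> R^o}) : exists u, forall v, L v = dot u v.
Proof.
have [n [e e_span]] := hilbert_dim hV.
have [u [Lu _]] := riesz_seq [seq e i | i <- enum 'I_n] L.
exists u => v; have [c ->] := e_span v.
rewrite !linear_sum; apply: eq_bigr => i _.
by rewrite !linearZ /= Lu// map_f// mem_enum.
Qed.

Lemma gradientE (F : V -> R^o) x v :
  differentiable F x -> 'd F x v = dot (gradient dot F x) v.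
Proof.
by move=> _; have /(xgetPex 0) -> := riesz ('d F x).
Qed.

Lemma gradient_quotient_cvg (F : V -> R^o) x d : differentiable F x ->
  (fun t : R => t^-1 * (F (x + t *: d) - F x)) @ 0^'
    --> dot (gradient dot F x) d.
Proof.
move=> dF; rewrite -gradientE// -deriveE//.
suff -> : (fun t : R => t^-1 * (F (x + t *: d) - F x)) =
    (fun h => h^-1 *: ((F \o shift x) (h *: d) - F x)).
  exact: (diff_derivable (v := d) dF).
by apply/funext => t /=; rewrite [x + _]addrC.
Qed.

(** Difference quotients from the right suffice, so the bound is asked for only on a segment, where
    convexity can provide it. *)
Lemma gradient_line_le (F : V -> R^o) x d (b : R) : differentiable F x ->
  (forall t : R, 0 < t <= 1 -> F (x + t *: d) - F x <= t * b) ->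
  dot (gradient dot F x) d <= b.
Proof.
move=> dF Fb; have := @gradient_quotient_cvg F x d dF.
move=> /cvg_dnbhs_at_right h; apply: (cvgr_to_le h).
near=> t.
have t0 : 0 < t by near: t; apply: nbhs_right_gt.
rewrite ler_pdivrMl// Fb// t0 /=.
by near: t; apply: nbhs_right_le.
Unshelve. all: by end_near. Qed.

Lemma is_derive_line (F : V -> R^o) u d (t : R) :
  differentiable F (u + t *: d) ->
  is_derive t 1 (fun s : R => F (u + s *: d) : R)
    (dot (gradient dot F (u + t *: d)) d).
Proof.
move=> dF; have := diff_derivable (v := d) dF.
rewrite -(gradientE _ dF) -(deriveE d dF) /derivable /derive /= => h.
have E : (fun h : R => h^-1 *: ((((fun s : R => F (u + s *: d)) \o shift t) (h *: 1)
      : R^o) - (F (u + t *: d) : R^o))) =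
  (fun h : R => h^-1 *: ((F \o shift (u + t *: d)) (h *: d) - F (u + t *: d))).
  apply/funext => k /=; congr (_ *: (F _ - _)).
  by rewrite [k *: 1]mulr1 scalerDl addrCA.
by split; rewrite /derivable /derive /= E.
Qed.

End InnerProduct.

(** * Descent lemma, gradient inequalities and the proximal step *)

Section SmoothFunctions.
Context (R : realType) (V : normedModType R) (dot : {dot V for @idfun R}).
Context (hV : finite_dimensional_hilbert dot).
Implicit Types (u v z : V).

Lemma lipschitz_gradient_upper (F : V -> R^o) (l : R) u w :
  (forall x, differentiable F x) -> l.-lipschitz (gradient dot F) ->
  F w <= F u + dot (gradient dot F u) (w - u) + l / 2 * `|w - u| ^+ 2.
Proof.
move=> dF lF; set d := w - u; set a := dot _ d; set b := l / 2 * _.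
(* With the quadratic model subtracted, the claim is [phi 1 <= phi 0]; by the mean value theorem it
   is enough that [dphi c <= 0], which Cauchy-Schwarz and the Lipschitz bound give. *)
pose phi (t : R) : R := F (u + t *: d) - (t * a + t ^+ 2 * b).
pose dphi (t : R) : R := dot (gradient dot F (u + t *: d)) d - (a + 2 * t * b).
have phiE (t : R) : is_derive t 1 phi (dphi t).
  apply: is_deriveB; first exact: is_derive_line.
  have -> : (fun t : R => t * a + t ^+ 2 * b) =
      (a *: id + b *: (id ^+ 2) : R -> R).
    by apply/funext => s; rewrite /= [s * a]mulrC [s ^+ 2 * b]mulrC.
  have tD := is_derive_id t (1 : R^o).
  apply: (is_derive_eq
    (is_deriveD (is_deriveZ a tD) (is_deriveZ b (is_deriveX 2 tD)))).
  rewrite /= expr1.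
  change (a * 1 + b * (2 * t * 1) = a + 2 * t * b); ring.
have phi_cont : {within `[0, 1], continuous phi}.
  by apply: derivable_within_continuous => t _; have [] := phiE t.
have [c] := @MVT R phi dphi 0 1 ltr01 (fun t _ => phiE t) phi_cont.
rewrite in_itv /= => /andP[c0 c1]; rewrite subr0 mulr1.
rewrite /phi /dphi scale0r addr0 scale1r expr1n expr0n /= !mul0r !mul1r.
rewrite addr0 subr0.
rewrite [u + d]addrC subrK.
have : dot (gradient dot F (u + c *: d) - gradient dot F u) d <= 2 * c * b.
  apply: le_trans (dot_cauchy hV _ _) _.
  have := lF (u + c *: d, u) (conj I I).
  rewrite /= addrAC subrr add0r normrZ (gtr0_norm c0) => h.
  apply: le_trans (ler_wpM2r (normr_ge0 d) h) _.
  by rewrite le_eqVlt /b; apply/orP; left; apply/eqP; field.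
rewrite dotBl -/a => h1 h2; lra.
Qed.

Lemma convex_gradient_lower (F : V -> R^o) u z : differentiable F u ->
  convex_function [set: V] F ->
  F u + dot (gradient dot F u) (z - u) <= F z.
Proof.
move=> dF cF; rewrite addrC -lerBrDr.
apply: (gradient_line_le hV dF) => t /andP[t0 t1].
have := cF (Itv01 (ltW t0) t1) z u (mem_setT _) (mem_setT _).
have -> : conv (Itv01 (ltW t0) t1) (z : convex_lmodType V)
    (u : convex_lmodType V) = u + t *: (z - u).
  by rewrite /conv /= scalerBl scale1r scalerBr addrCA.
by rewrite convRE /= /unstable.onem => h; rewrite lerBlDr; lra.
Qed.

Lemma indicator_in (S : set V) z : S z -> indicator S z = 0%E.
Proof. by move=> Sz; rewrite /indicator mem_set. Qed.

Lemma weakly_convex_gradient_lower (G : V -> \bar R) (S : set V) (b : R) x z :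
  convex_set S -> 0 <= b -> (forall y, S y -> G y \is a fin_num) ->
  weakly_convex_modulus b S G -> differentiable (fine \o G : V -> R^o) x ->
  S x -> S z ->
  dot (gradient dot (fine \o G) x) (z - x)
    <= fine (G z) - fine (G x) + b / 2 * `|z - x| ^+ 2.
Proof.
move=> cS b0 Gfin wG dG Sx Sz.
apply: (gradient_line_le hV dG) => t /andP[t0 t1].
have lineE : t *: z + (1 - t) *: x = x + t *: (z - x).
  by rewrite scalerBl scale1r scalerBr addrCA.
have St : S (x + t *: (z - x)).
  have := cS z x (Itv01 (ltW t0) t1) (mem_set Sz) (mem_set Sx).
  by rewrite /conv /= /unstable.onem lineE => /set_mem.
have := wG z x t; rewrite (ltW t0) t1 => /(_ isT).
rewrite lineE !indicator_in// !adde0.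
rewrite -(fineK (Gfin _ St)) -(fineK (Gfin _ Sx)) -(fineK (Gfin _ Sz)) /=.
rewrite -!EFinD lee_fin.
(* Expanding all squares around [x] cancels the constant and linear terms; what remains is
   [b / 2 * (t - t ^+ 2) * q], and the [t ^+ 2] part is dropped by its sign. *)
have -> : `|z| ^+ 2 = `|x| ^+ 2 + 2 * dot x (z - x) + `|z - x| ^+ 2.
  by rewrite -(normD_sqr hV) addrC subrK.
rewrite (normD_sqr hV) dotZr normrZ (gtr0_norm t0) exprMn.
set p := `|x| ^+ 2; set q := `|z - x| ^+ 2.
have := mulr_ge0 b0 (mulr_ge0 (sqr_ge0 t) (sqr_ge0 `|z - x|)); rewrite -/q.
by move=> bq h; rewrite lerBlDr; lra.
Qed.

(** Sum of the proximal comparison of [w] with [y], the descent lemma from [u] to [w], the convexity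
    inequality from [u] to [y], [th] times the bound on [dot G (w - x)], and Young's inequality with
    weight [c] for [dot (w - x) d]. The condition on [s] absorbs the weak convexity error
    [th * beta / 2] into the proximal term. *)
Lemma prox_step_inequality (F : V -> R^o) (l beta s tau th kap mu c : R)
    (x d G w y : V) (fw fy gw gx : R) :
  (forall x, differentiable F x) -> l.-lipschitz (gradient dot F) ->
  convex_function [set: V] F ->
  0 < tau -> 0 <= th -> 0 <= mu -> 0 < c -> th * beta * tau <= s ->
  dot G (w - x) <= gw - gx + beta / 2 * `|w - x| ^+ 2 ->
  let u := x + kap *: d in
  let v := x + mu *: d in
  fw + (F u + dot (gradient dot F u) (w - u)
     + (2 * tau)^-1 * `|w - (v + (tau * th) *: G)| ^+ 2 + l / 2 * `|w - u| ^+ 2)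
  <= fy + (F u + dot (gradient dot F u) (y - u)
     + (2 * tau)^-1 * `|y - (v + (tau * th) *: G)| ^+ 2 + l / 2 * `|y - u| ^+ 2) ->
  F w + fw - th * gw + 2^-1 * ((1 - s) / tau - c * mu / tau) * `|w - x| ^+ 2
  <= F y + fy - th * gx + (2 * tau)^-1 * `|y - x| ^+ 2
     - mu / tau * dot (y - x) d - th * dot G (y - x) + l / 2 * `|y - u| ^+ 2
     + mu / (2 * c * tau) * `|d| ^+ 2.
Proof.
move=> dF lF cF tau0 th0 mu0 c0 hs hG u v.
(* The last term of the expansion does not depend on [z] and cancels between [w] and [y]. *)
have sqE z : (2 * tau)^-1 * `|z - (v + (tau * th) *: G)| ^+ 2 =
    (2 * tau)^-1 * `|z - x| ^+ 2 - mu / tau * dot (z - x) d - th * dot G (z - x)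
    + (2 * tau)^-1 * `|mu *: d + (tau * th) *: G| ^+ 2.
  have -> : z - (v + (tau * th) *: G) = (z - x) - (mu *: d + (tau * th) *: G).
    by rewrite /v -addrA opprD addrA.
  rewrite (normB_sqr hV (z - x)) (dotDr dot (mu *: d)) !dotZr [dot G _]dotC.
  by field; lra.
rewrite !sqE => {sqE}.
have := lipschitz_gradient_upper u w dF lF.
have := convex_gradient_lower y (dF u) cF.
have := ler_wpM2l (divr_ge0 mu0 (ltW tau0)) (dot_young hV (w - x) d c0).
have := ler_wpM2l th0 hG.
have := ler_wpM2r (divr_ge0 (sqr_ge0 `|w - x|) (ltW tau0)) hs.
have -> : th * beta * tau * (`|w - x| ^+ 2 / tau) = th * beta * `|w - x| ^+ 2.
  by field; lra.
have -> : mu / (2 * c * tau) * `|d| ^+ 2 = 2^-1 * (mu / tau * (`|d| ^+ 2 / c)).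
  by field; lra.
have -> : 2^-1 * ((1 - s) / tau - c * mu / tau) * `|w - x| ^+ 2 =
  (2 * tau)^-1 * `|w - x| ^+ 2 - 2^-1 * (s * (`|w - x| ^+ 2 / tau))
   - 2^-1 * (mu / tau * (c * `|w - x| ^+ 2)) by field; lra.
lra.
Qed.

End SmoothFunctions.

(** * Frechet subgradients, and their directional bound for a finite maximum *)

Section Subdifferentials.
Context (R : realType) (V : normedModType R) (dot : {dot V for @idfun R}).
Context (hV : finite_dimensional_hilbert dot).
Implicit Types (u v z : V).

Lemma frechet_of_quadratic_minorant (h : V -> \bar R) x u (K : R) :
  h x \is a fin_num -> 0 <= K ->
  (forall z, h x + (dot u (z - x) - K * `|z - x| ^+ 2)%:E <= h z)%E ->
  frechet_subdifferential dot h x u.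
Proof.
move=> hx K0 hh; split=> //; rewrite limf_einfE.
apply/lee_addgt0Pr => e e0.
(* On the ball of radius [e / (K + 1)] the quotient is at least [- e]; the [+ 1] keeps the radius
   meaningful when [K = 0]. *)
have K1 : 0 < K + 1 by lra.
rewrite -leeBlDr// sub0e.
set q := fun z => ((h z - h x - (dot u (z - x))%:E) * (`|z - x|^-1)%:E)%E.
apply: le_trans (_ : ereal_inf (q @` (ball x (e / (K + 1)) `\ x)) <= _)%E;
  last first.
  apply: ereal_sup_ubound; exists (ball x (e / (K + 1)) `\ x) => //.
  exact: dnbhs_ball (divr_gt0 e0 K1).
apply: le_ereal_inf_tmp => _ [z [+ /eqP zx] <-].
rewrite /q -ball_normE /= distrC => zxe.
have d0 : 0 < `|z - x| by rewrite normr_gt0 subr_eq0.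
have := hh z; rewrite -(fineK hx); case: (h z) => [r| |] //.
- rewrite -EFinD lee_fin -EFinB -EFinM lee_fin => hr.
  rewrite ler_pdivlMr//.
  have := ltW zxe; rewrite ler_pdivlMr// mulrC => h1.
  have := ler_wpM2r (ltW d0) h1.
  have := mulr_ge0 (normr_ge0 (z - x)) (normr_ge0 (z - x)).
  rewrite expr2 in hr; lra.
- by move=> _; rewrite [X in (X * _)%E]/= gt0_mulye ?lte_fin ?invr_gt0// leey.
Qed.

Lemma frechet_near (h : V -> \bar R) x u (e : R) : 0 < e ->
  frechet_subdifferential dot h x u ->
  \forall z \near x, (h x + (dot u (z - x) - e * `|z - x|)%:E <= h z)%E.
Proof.
move=> e0 [hx]; rewrite limf_einfE => hs.
set q := fun z => ((h z - h x - (dot u (z - x))%:E) * (`|z - x|^-1)%:E)%E.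
have : ((- e)%:E < ereal_sup [set ereal_inf (q @` A) | A in x^'])%E.
  by apply: lt_le_trans hs; rewrite lte_fin oppr_lt0.
move=> /ereal_sup_gt[_ [A xA <-]] eA.
have xA' : \forall z \near x, z != x -> A z by exact: xA.
near=> z.
have [->|zx] := eqVneq z x.
  by rewrite subrr normr0 linear0r mulr0 subr0 adde0.
have d0 : 0 < `|z - x| by rewrite normr_gt0 subr_eq0.
have Az : A z by move: zx; near: z.
have := lt_le_trans eA (ereal_inf_lbound (ex_intro2 _ _ z Az erefl)).
rewrite /q -(fineK hx); case: (h z) => [r| |] //.
- rewrite -EFinB -EFinM lte_fin -EFinD lee_fin ltr_pdivlMr//; lra.
- by rewrite /= leey.
- by rewrite [X in (X * _)%E]/= gt0_mulNye ?lte_fin ?invr_gt0.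
Unshelve. all: by end_near. Qed.

(** If every piece of [I] violated the bound, the finitely many quotients along [d] would all fall
    below [dot v d - e] for a common small [t]. But [g] coincides with one of these pieces at
    [y + t *: d] and dominates it at [y], which contradicts the Frechet inequality for [v]. *)
Lemma frechet_max_direction (p : nat) (g : V -> \bar R)
    (gi : 'I_p -> V -> \bar R) (I : set 'I_p) y v d (e : R) : 0 < e ->
  frechet_subdifferential dot g y v ->
  (\forall z \near y, exists2 i, I i & g z = gi i z) ->
  (forall i, (gi i y <= g y)%E) ->
  (forall i, differentiable (fine \o gi i : V -> R^o) y) ->
  (\forall z \near y, forall i, gi i z \is a fin_num) ->
  exists2 i, I i & dot v d <= dot (gradient dot (fine \o gi i) y) d + e.
Proof.
move=> e0 gv gI gig gdiff gfin.
apply: contrapT => /forall2NP hI.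
have lineC : (fun t : R => y + t *: d) @ 0^' --> y.
  rewrite -[X in _ --> X]addr0 -[X in _ --> _ + X](scale0r d).
  apply: cvgD; first exact: cvg_cst.
  by apply: cvgZr_tmp; apply: cvg_within.
(* With this slope the error along [d] is at most [t * e]; the [+ 1] covers [d = 0]. *)
have e1 : 0 < e / (`|d| + 1) by rewrite divr_gt0// ltr_wpDl.
have fr := frechet_near e1 gv.
have quot : \forall t \near (0:R)^'+, forall i, I i ->
    fine (gi i (y + t *: d)) - fine (gi i y) < t * (dot v d - e).
  apply: filter_forall => i.
  have [NIi|hi] := hI i; first by near=> t => /NIi.
  have hi' : dot (gradient dot (fine \o gi i) y) d < dot v d - e.
    by rewrite ltrBrDr ltNge; apply/negP.
  have /cvg_dnbhs_at_right q :=
    @gradient_quotient_cvg _ _ dot hV (fine \o gi i) y d (gdiff i).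
  have ql := cvgr_lt _ q _ hi'.
  near=> t => _; have t0 : 0 < t by near: t; apply: nbhs_right_gt.
  by rewrite -ltr_pdivrMl//; near: t; exact: ql.
suff : \forall t \near (0:R)^'+, False by move=> /filter_ex[].
have lineR := cvg_dnbhs_at_right lineC.
near=> t.
have t0 : 0 < t by near: t; apply: nbhs_right_gt.
have [i Ii gE] : exists2 i, I i & g (y + t *: d) = gi i (y + t *: d).
  by near: t; exact: (lineR _ gI).
have : (g y + (dot v (y + t *: d - y)
    - e / (`|d| + 1) * `|y + t *: d - y|)%R%:E <= g (y + t *: d)%R)%E.
  by near: t; exact: (lineR _ fr).
rewrite [y + _]addrC addrK dotZr normrZ (gtr0_norm t0) [_ + y]addrC gE.
have : forall i, gi i (y + t *: d) \is a fin_num.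
  by near: t; exact: (lineR _ gfin).
move=> /(_ i)/fineK <-.
have : forall i, gi i y \is a fin_num by exact: nbhs_singleton gfin.
move=> /(_ i) fy h.
have : fine (gi i (y + t *: d)) - fine (gi i y) < t * (dot v d - e).
  suff : forall i, I i ->
      fine (gi i (y + t *: d)) - fine (gi i y) < t * (dot v d - e) by apply.
  by near: t.
have := le_trans (leeD2r _ (gig i)) h; rewrite -(fineK fy) -EFinD lee_fin /=.
have : e / (`|d| + 1) * (t * `|d|) <= t * e.
  rewrite mulrCA ler_pM2l// mulrAC ler_pdivrMr ?ltr_wpDl//.
  by rewrite ler_pM2l// lerDl.
lra.
Unshelve. all: by end_near. Qed.

End Subdifferentials.

(** * Finiteness, continuity and subgradients of numerator and denominator *)

Section FractionalFacts.
Context (R : realType) (V : normedModType R) (dot : {dot V for @idfun R}).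
Context (hV : finite_dimensional_hilbert dot).
Context (S : set V) (hSconvex : convex_set S).
Context (f g : V -> \bar R) (fs : V -> R^o) (fn : V -> \bar R).
Context (p : nat) (gi : 'I_p -> V -> \bar R) (l beta m M : R).
Context (hf : numerator_assumption dot S f fs fn l).
Context (hg : denominator_assumption dot S f g gi beta m M).
Implicit Types (u v z : V).

Local Notation dom := (S `&` edom f).
Local Notation fr := (fine \o f).
Local Notation gr := (fine \o g).
Local Notation gir i := (fine \o gi i : V -> R^o).
Local Notation ratio z := (fine (fractional_objective f g z)).

Lemma numerator_fin z : dom z -> f z \is a fin_num.
Proof.
move=> [_ fz]; rewrite fin_numElt fz andbT (num_sum hf) ltNye_eq.
by have := (num_nonsmooth_proper hf).1 z; case: (fn z).
Qed.

Lemma nonsmooth_fin z : dom z -> fn z \is a fin_num.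
Proof. by move=> /numerator_fin; rewrite (num_sum hf) fin_numD => /andP[]. Qed.

Lemma numerator_fineE z : dom z -> fr z = fs z + fine (fn z).
Proof. by move=> /nonsmooth_fin fz; rewrite /= (num_sum hf) fineD. Qed.

Lemma domP z : S z -> (fn z < +oo)%E -> dom z.
Proof.
move=> Sz fnz; split=> //.
by rewrite /edom /= (num_sum hf) lte_add_pinfty ?ltry.
Qed.

Lemma denominator_fin z : S z -> g z \is a fin_num.
Proof.
move=> /(den_finite_pos hg)/andP[g0 goo].
by rewrite fin_numElt goo (lt_trans _ g0).
Qed.

Lemma pieces_fin i z : S z -> gi i z \is a fin_num.
Proof.
move=> Sz; have [U [_ SU Ufin _]] := den_pieces_smooth hg i.
by apply: Ufin; exact: SU.
Qed.

Lemma piece_le_max i z : (gi i z <= g z)%E.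
Proof. by rewrite (den_max hg); exact: (le_bigmax -oo%E (fun j => gi j z)). Qed.

Lemma piece_le_max_fine i z : S z -> gir i z <= gr z.
Proof.
move=> Sz; rewrite -lee_fin /= !fineK ?piece_le_max//.
  exact: denominator_fin.
exact: pieces_fin.
Qed.

Lemma max_attained z : (-oo < g z)%E -> exists i, g z = gi i z.
Proof.
(* An empty maximum equals [-oo], which excludes [p = 0]. *)
rewrite (den_max hg); case: p gi => [|q] gj; first by rewrite big_ord0.
move=> _; have [i _ ->] := @eq_bigmax _ _ _ -oo%E ord0 predT
  (fun j => gj j z) isT (fun _ _ => leNye _).
by exists i.
Qed.

Lemma bounds_fine z : dom z -> m <= gr z <= M.
Proof.
move=> Dz; rewrite -!lee_fin /= fineK; first exact: (den_bounds hg).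
by apply: denominator_fin; case: Dz.
Qed.

Lemma denominator_fine_gt0 z : dom z -> 0 < gr z.
Proof. by move=> /bounds_fine/andP[+ _]; apply: lt_le_trans (den_m_gt0 hg). Qed.

Lemma objectiveE z : dom z -> fractional_objective f g z = (fr z / gr z)%:E.
Proof.
move=> Dz; rewrite /fractional_objective -(fineK (numerator_fin Dz)).
rewrite -(fineK (denominator_fin Dz.1)) inver gt_eqF ?EFinM//.
exact: denominator_fine_gt0.
Qed.

Lemma ratioK z : dom z -> ratio z * gr z = fr z.
Proof.
move=> Dz; rewrite objectiveE//= divfK// gt_eqF//.
exact: denominator_fine_gt0.
Qed.

Lemma ratio_ge0 z : dom z -> 0 <= ratio z.
Proof.
move=> Dz; rewrite objectiveE//= divr_ge0//; last first.
  exact/ltW/denominator_fine_gt0.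
by rewrite fine_ge0// (num_ge0 hf).
Qed.

Lemma pieces_differentiable i z : S z -> differentiable (gir i) z.
Proof.
by move=> Sz; have [U [_ SU _ /(_ z (SU _ Sz))[]]] := den_pieces_smooth hg i.
Qed.

Lemma pieces_gradient_continuous i z : S z ->
  {for z, continuous (gradient dot (gir i))}.
Proof.
by move=> Sz; have [U [_ SU _ /(_ z (SU _ Sz))[]]] := den_pieces_smooth hg i.
Qed.

Lemma pieces_near i z : S z ->
  \forall y \near z, gi i y \is a fin_num /\ differentiable (gir i) y.
Proof.
move=> Sz; have [U [Uopen SU Ufin Udiff]] := den_pieces_smooth hg i.
have Uz : nbhs z U by apply: open_nbhs_nbhs; split=> //; exact: SU.
by apply: filterS Uz => y Uy; split; [exact: Ufin | exact: (Udiff y Uy).1].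
Qed.

Lemma pieces_continuous i z : S z -> {for z, continuous (gir i)}.
Proof.
move=> Sz; apply: differentiable_continuous; exact: pieces_differentiable.
Qed.

Lemma piece_gradient_lower i z y : S z -> S y ->
  dot (gradient dot (gir i) z) (y - z)
    <= gir i y - gir i z + beta / 2 * `|y - z| ^+ 2.
Proof.
move=> Sz Sy; apply: (weakly_convex_gradient_lower hV hSconvex) => //.
- exact: (den_modulus_ge0 hg).
- by move=> *; apply: pieces_fin.
- exact: (den_pieces_weakly_convex hg).
- exact: pieces_differentiable.
Qed.

(** A piece inactive at [z] lies strictly below an active one there, hence also nearby by
    continuity, so it cannot attain the maximum. *)
Lemma active_near z : S z ->
  \forall y \near z, exists2 i, active_set g gi 0 z i & g y = gi i y.
Proof.
move=> Sz; have [j gj] := max_attained ((den_proper hg).1 z).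
have fin_near : \forall y \near z, forall i, gi i y \is a fin_num.
  by apply: filter_forall => i; apply: filterS (pieces_near i Sz) => y [].
have inactive_lt : \forall y \near z, forall i,
    active_set g gi 0 z i \/ gir i y < gir j y.
  apply: filter_forall => i; have [Ii|Ii] := pselect (active_set g gi 0 z i).
    by near=> y; left.
  have lt0 : 0 < gir j z - gir i z.
    rewrite subr_gt0 -lte_fin /= !fineK ?pieces_fin// -gj.
    by move/negP: Ii; rewrite -ltNge sube0.
  have h := cvgr_gt _
    (cvgB (pieces_continuous (i:=j) Sz) (pieces_continuous (i:=i) Sz)) _ lt0.
  by near=> y; right; rewrite -subr_gt0; near: y; exact: h.
near=> y.
have fy : forall i, gi i y \is a fin_num by near: y.
have [k gk] : exists k, g y = gi k y.
  exact/max_attained/(den_proper hg).1.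
exists k => //; have : forall i, active_set g gi 0 z i \/ gir i y < gir j y.
  by near: y.
move=> /(_ k)[//|]; rewrite -lte_fin /= !fineK// -gk ltNge => /negP[].
exact: piece_le_max.
Unshelve. all: by end_near. Qed.

(** One piece active at the limit bounds [g] from below along the sequence; finiteness of the family
    makes the upper bounds hold for all pieces at once. *)
Lemma denominator_cvg (y : nat -> V) z :
  (forall n, S (y n)) -> S z -> y @ \oo --> z ->
  gr \o y @ \oo --> (gr z : R^o).
Proof.
move=> Sy Sz yz; have [j gj] := max_attained ((den_proper hg).1 z).
have gicvg i : gir i \o y @ \oo --> gir i z.
  by apply: cvg_comp yz _; exact: pieces_continuous.
apply/cvgrPdist_le => e e0; near=> n.
rewrite ler_distlC; apply/andP; split.
  apply: le_trans (piece_le_max_fine j (Sy n)); rewrite [gr z]/= gj.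
  by near: n; apply: (cvgr_ge _ (gicvg j)); rewrite ltrBlDr ltrDl.
have [k gk] := max_attained ((den_proper hg).1 (y n)).
rewrite /= gk; apply: le_trans (_ : gir k z + e <= _).
  suff : forall i, gir i (y n) <= gir i z + e by apply.
  near: n; apply: filter_forall => i.
  by apply: (cvgr_le _ (gicvg i)); rewrite ltrDl.
by rewrite lerD2r piece_le_max_fine.
Unshelve. all: by end_near. Qed.

Lemma active_setE (e : R) z i : S z ->
  active_set g gi e z i <-> gr z - e <= gir i z.
Proof.
move=> Sz; rewrite /active_set /= -(fineK (denominator_fin Sz)).
by rewrite -(fineK (pieces_fin i Sz)) -EFinB lee_fin.
Qed.

Lemma active0_fine z i : S z -> active_set g gi 0 z i -> gir i z = gr z.
Proof.
move=> Sz /(active_setE _ _ Sz); rewrite subr0 => h; apply/eqP.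
by rewrite eq_le h piece_le_max_fine.
Qed.

(* In place of the inclusion of the limiting subdifferential of [g] in the
   convex hull of the active gradients, the corresponding inequality between
   support functions, which needs no separation argument. *)
Lemma limiting_max_direction z u d (e : R) : S z -> 0 < e ->
  limiting_subdifferential dot g z u ->
  exists2 i, active_set g gi 0 z i &
    dot u d <= dot (gradient dot (gir i) z) d + e.
Proof.
move=> Sz e0 [_ [y [v [yz _ gv vu]]]].
(* One third each for the Frechet bound at [y n], the continuity of the gradients, and the
   convergence of [v n] to [u]. *)
have e3 : 0 < e / 3 by rewrite divr_gt0.
have fin_near : \forall x \near z, forall i,
    gi i x \is a fin_num /\ differentiable (gir i) x.
  by apply: filter_forall => i; exact: (pieces_near i Sz).
(* Passing to the interior turns a property near [z] into one near every late [y n]. *)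
have near_active : \forall n \near \oo, \forall x \near y n,
    exists2 i, active_set g gi 0 z i & g x = gi i x.
  exact: (yz _ (nbhs_interior (active_near Sz))).
have near_fin : \forall n \near \oo, \forall x \near y n, forall i,
    gi i x \is a fin_num /\ differentiable (gir i) x.
  exact: (yz _ (nbhs_interior fin_near)).
have near_grad : \forall n \near \oo, forall i,
    dot (gradient dot (gir i) (y n)) d
      <= dot (gradient dot (gir i) z) d + e / 3.
  apply: filter_forall => i.
  have gradC : gradient dot (gir i) \o y @ \oo --> gradient dot (gir i) z.
    by apply: cvg_comp yz _; exact: pieces_gradient_continuous.
  apply: (cvgr_le _ (dot_cvg hV _ gradC (cvg_cst d))).
  by rewrite ltrDl.
have near_u : \forall n \near \oo, dot u d - e / 3 <= dot (v n) d.
  by apply: (cvgr_ge _ (dot_cvg hV _ vu (cvg_cst d))); rewrite ltrBlDr ltrDl.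
(* The piece found may vary with [n], but the gradient estimate covers all pieces, so a single late
   [n] is enough. *)
suff : \forall n \near \oo, exists2 i, active_set g gi 0 z i &
    dot u d <= dot (gradient dot (gir i) z) d + e by move=> /filter_ex[].
near=> n.
have fn_n : \forall x \near y n, forall i,
    gi i x \is a fin_num /\ differentiable (gir i) x.
  by near: n.
have [||i||i Ii h] := @frechet_max_direction R V dot hV p g gi
  (active_set g gi 0 z) (y n) (v n) d (e / 3) e3 (gv n).
- by near: n; exact: near_active.
- by move=> i; exact: piece_le_max.
- by have /(_ i)[] := nbhs_singleton fn_n.
- by apply: filterS fn_n => x hx i; have [] := hx i.
exists i => //.
have h1 : dot u d - e / 3 <= dot (v n) d by near: n.
have h2 : forall i, dot (gradient dot (gir i) (y n)) d
    <= dot (gradient dot (gir i) z) d + e / 3.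
  by near: n.
have := h2 i; lra.
Unshelve. all: by end_near. Qed.

(** Outside [S] or the domain of [f] the sum is [+oo], so testing the minorant on the feasible
    domain makes [v] a Frechet subgradient, and constant sequences make it a limiting one. *)
Lemma limiting_of_quadratic_minorant z v (K : R) : dom z -> 0 <= K ->
  (forall y, dom y -> fr z + dot v (y - z) - K * `|y - z| ^+ 2 <= fr y) ->
  limiting_subdifferential dot (fun y => f y + indicator S y)%E z v.
Proof.
move=> Dz K0 hK.
have hz : (f z + indicator S z = f z)%E by rewrite (indicator_in Dz.1) adde0.
have zfin : (f z + indicator S z)%E \is a fin_num by rewrite hz numerator_fin.
split=> //; exists (cst z), (cst v); split;
  [exact: cvg_cst | exact: (cvg_cst (f z + indicator S z)%E) | move=> n
  | exact: cvg_cst].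
apply: (frechet_of_quadratic_minorant zfin K0) => y; rewrite hz.
have fNy : (f y != -oo)%E.
  by rewrite (num_sum hf); have := (num_nonsmooth_proper hf).1 y; case: (fn y).
have [Sy|NSy] := pselect (S y); last first.
  by rewrite /indicator memNset// addey// leey.
rewrite (indicator_in Sy) adde0.
have [fy|] := pselect (f y < +oo)%E; last first.
  by move/negP; rewrite -leNgt leye_eq => /eqP ->; rewrite leey.
have Dy : dom y by [].
rewrite -(fineK (numerator_fin Dz)) -(fineK (numerator_fin Dy)) -EFinD lee_fin.
by have := hK _ Dy; rewrite addrA.
Qed.

(** Lower semicontinuity of [fn] combines with continuity of [fs]; the finite limit [a] forces
    [fn z < +oo]. *)
Lemma numerator_lsc_limit (y : nat -> V) z (a : R) :
  (forall n, dom (y n)) -> S z -> y @ \oo --> z ->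
  fr \o y @ \oo --> (a : R^o) ->
  dom z /\ fr z <= a.
Proof.
move=> Dy Sz yz fya.
have fsC : fs \o y @ \oo --> fs z.
  apply: cvg_comp yz _; apply: differentiable_continuous.
  exact: (num_smooth hf (I : [set: V] z)).1.
have fnz : (fn z <= (a - fs z)%:E)%E.
  rewrite leNgt; apply/negP => lt_fn.
  (* A real level strictly between is needed, also when [fn z = +oo], because lower semicontinuity
     is tested at real levels. *)
  have [b ab bfn] : exists2 b, a - fs z < b & (b%:E < fn z)%E.
    case: (fn z) lt_fn => [r| |] // => [|_].
      rewrite lte_fin => h.
      by exists ((a - fs z + r) / 2); rewrite ?lte_fin; lra.
    by exists (a - fs z + 1); rewrite ?ltry// ltrDl.
  have [W Wz hW] := num_nonsmooth_lsc hf bfn.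
  suff : fs z + b <= a by lra.
  apply: (@ler_cvg_to _ \oo _ _ (fun n => fs (y n) + b) (fr \o y)) => //.
    exact: (cvgD fsC (cvg_cst b)).
  near=> n; change (fs (y n) + b <= fr (y n)).
  rewrite (numerator_fineE (Dy n)) lerD2l -lee_fin.
  by rewrite fineK ?nonsmooth_fin// ltW// hW//; near: n; exact: (yz _ Wz).
have Dz : dom z by apply: domP => //; exact: le_lt_trans fnz (ltry _).
split=> //; rewrite (numerator_fineE Dz).
by move: fnz; rewrite -(fineK (nonsmooth_fin Dz)) lee_fin; lra.
Unshelve. all: by end_near. Qed.

End FractionalFacts.

(** * Descent of the merit function along the iterates *)

Section Algorithm.
Context (R : realType) (V : normedModType R) (dot : {dot V for @idfun R}).
Context (hV : finite_dimensional_hilbert dot).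
Context (S : set V) (hSclosed : closed S) (hSconvex : convex_set S).
Context (f g : V -> \bar R) (fs : V -> R^o) (fn : V -> \bar R).
Context (p : nat) (gi : 'I_p -> V -> \bar R) (l beta m M : R).
Context (hf : numerator_assumption dot S f fs fn l).
Context (hg : denominator_assumption dot S f g gi beta m M).
Context (delta eps zeta mubar kappabar : R) (tau kappa mu : nat -> R).
Context (w : nat -> 'I_p -> V) (ihat : nat -> 'I_p) (x : nat -> V).
Context (hx : extrapolated_proximal_subgradient dot S f g fs fn gi l beta m M
          delta eps zeta mubar kappabar tau kappa mu w ihat x).

Local Notation dom := (S `&` edom f).
Local Notation fr := (fine \o f).
Local Notation gr := (fine \o g).
Local Notation gir i := (fine \o gi i : V -> R^o).
Local Notation theta n := (fine (fractional_objective f g (x n))).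
Local Notation d n := (x n - x n.-1).
Local Notation u n := (x n + kappa n *: d n).
Local Notation s := (Num.sqrt beta * zeta).
(** Weight of Young's inequality, chosen so that [c / M] and [1 / (c * m)] both equal
    [1 / Num.sqrt (m * M)]: the two losses are later divided by [M] and by [m]. *)
Local Notation c := (M / Num.sqrt (m * M)).
Local Notation grad i := (gradient dot (gir i)).

(** The subproblem has a finite value at the competitor [x n], hence also at its minimizer. *)
Lemma subproblem_dom n i : dom (x n) ->
  active_set g gi eps (x n) i -> dom (w n i).
Proof.
move=> Dx Ii; have [Sw /(_ _ Dx.1)] := alg_subproblem hx Ii.
rewrite /prox_objective -(fineK (nonsmooth_fin hf Dx)) -EFinD => h.
apply: (domP hf) => //; move: h; case: (fn _) => //= r _; exact: ltry.
Qed.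

Lemma feasible n : dom (x n).
Proof.
elim: n => [|n IH]; first exact: (alg_start hx).
rewrite (alg_next hx); apply: subproblem_dom => //.
by have [] := alg_selection hx n.
Qed.

Lemma tau_gt0 n : 0 < tau n.
Proof. by have /andP[] := alg_tau hx n. Qed.

Lemma tau_max n : tau n * Num.max (Num.sqrt beta * theta n / zeta) delta <= 1.
Proof.
have /andP[_] := alg_tau hx n; rewrite ler_pdivlMr//.
by rewrite lt_max (alg_delta hx) orbT.
Qed.

Lemma tau_delta n : tau n * delta <= 1.
Proof.
by apply: le_trans (tau_max n); rewrite ler_pM2l ?tau_gt0// le_max lexx orbT.
Qed.

(** The step-size rule, multiplied once by [Num.sqrt beta], is the absorption condition of
    [prox_step_inequality]. *)
Lemma tau_beta n : theta n * beta * tau n <= s.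
Proof.
have z0 := alg_zeta hx.
have : tau n * (Num.sqrt beta * theta n / zeta) <= 1.
  by apply: le_trans (tau_max n); rewrite ler_pM2l ?tau_gt0// le_max lexx.
rewrite mulrA ler_pdivrMr// mul1r => h.
have := ler_wpM2l (sqrtr_ge0 beta) h.
suff -> : Num.sqrt beta * (tau n * (Num.sqrt beta * theta n)) =
  theta n * beta * tau n by [].
rewrite -[in RHS](sqr_sqrtr (den_modulus_ge0 hg)); ring.
Qed.

Lemma sqrt_mM_gt0 : 0 < Num.sqrt (m * M).
Proof. by rewrite sqrtr_gt0 mulr_gt0 ?(den_m_gt0 hg) ?(den_M_gt0 hg). Qed.

Lemma young_weight_gt0 : 0 < c.
Proof. by rewrite divr_gt0 ?(den_M_gt0 hg) ?sqrt_mM_gt0. Qed.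

Lemma mu_ge0 n : 0 <= mu n.
Proof. by have /andP[] := alg_mu hx n. Qed.

Lemma mu_tau n : mu n / tau n <= mubar.
Proof. by rewrite ler_pdivrMr ?tau_gt0//; have /andP[] := alg_mu hx n. Qed.

(* The selection in Step 3 transfers the estimate for every active piece [i]
   to [x n.+1], so that [i] may be chosen freely. *)
Lemma step_inequality n i y : active_set g gi eps (x n) i -> dom y ->
  fr (x n.+1) - theta n * gr (x n.+1)
    + 2^-1 * ((1 - s) / tau n - c * mu n / tau n) * `|x n.+1 - x n| ^+ 2
  <= fr y - theta n * gir i (x n) + (2 * tau n)^-1 * `|y - x n| ^+ 2
     - mu n / tau n * dot (y - x n) (d n)
     - theta n * dot (grad i (x n)) (y - x n) + l / 2 * `|y - u n| ^+ 2
     + mu n / (2 * c * tau n) * `|d n| ^+ 2.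
Proof.
move=> Ii Dy; have Dw := subproblem_dom (feasible n) Ii.
have Dx := feasible n; have Dx1 := feasible n.+1.
have [_ /(_ _ Dy.1)] := alg_subproblem hx Ii.
rewrite /prox_objective.
rewrite -(fineK (nonsmooth_fin hf Dy)) -(fineK (nonsmooth_fin hf Dw)).
rewrite -!EFinD lee_fin => hprox.
(* Since [gi i] is at most [g] at [w n i], only the value at [x n] still refers to the piece [i]. *)
have hgw : dot (grad i (x n)) (w n i - x n) <=
    gr (w n i) - gir i (x n) + beta / 2 * `|w n i - x n| ^+ 2.
  apply: le_trans (piece_gradient_lower hV hSconvex hg i Dx.1 Dw.1) _.
  by rewrite !lerD2r (piece_le_max_fine hg)//; case: Dw.
have := prox_step_inequality hV (fun z => (num_smooth hf (I : [set: V] z)).1)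
  (num_grad_lipschitz hf) (num_smooth_convex hf) (tau_gt0 n)
  (ratio_ge0 hf hg Dx) (mu_ge0 n) young_weight_gt0 (tau_beta n) hgw hprox.
rewrite -!(numerator_fineE hf)//.
apply: le_trans.
have [_ /(_ _ Ii)] := alg_selection hx n.
rewrite -(alg_next hx).
rewrite -(fineK (numerator_fin hf Dw)) -(fineK (numerator_fin hf Dx1)).
rewrite -(fineK (denominator_fin hg Dw.1)) -(fineK (denominator_fin hg Dx1.1)).
rewrite -!EFinM -!EFinB -!EFinD lee_fin /=.
by have -> : M * mu n / (Num.sqrt (m * M) * tau n) = c * mu n / tau n
  by field; rewrite !gt_eqF ?tau_gt0 ?sqrt_mM_gt0.
Qed.

(** [A] bounds the coefficient in the selection rule from below uniformly in [n], through
    [tau n * delta <= 1] and [mu n / tau n <= mubar]; [C] is the inertial weight of the merit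
    function. *)
Local Notation A := ((1 - s) * delta - c * mubar).
Local Notation C :=
  (l * kappabar ^+ 2 / (2 * m) + mubar / (2 * Num.sqrt (m * M))).

Lemma mubar_ge0 : 0 <= mubar.
Proof. by have /andP[] := alg_mubar hx. Qed.

Lemma merit_weight_ge0 : 0 <= C.
Proof.
rewrite addr_ge0//.
  apply: divr_ge0; first by rewrite mulr_ge0 ?sqr_ge0 ?(num_modulus_ge0 hf).
  by rewrite mulr_ge0// ltW// (den_m_gt0 hg).
by rewrite divr_ge0 ?mubar_ge0// mulr_ge0// sqrtr_ge0.
Qed.

Lemma step_coef_ge n : A <= (1 - s) / tau n - c * mu n / tau n.
Proof.
apply: lerB.
  rewrite ler_pM2l; last exact: (alg_zeta_beta hx).
  by rewrite -[(tau n)^-1]mul1r ler_pdivlMr ?tau_gt0// mulrC tau_delta.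
by rewrite -mulrA ler_pM2l ?young_weight_gt0// mu_tau.
Qed.

(** This is what the upper bounds on [kappabar] and [mubar] are designed for: each step gains more
    than the inertia costs. *)
Lemma merit_weight_lt : C < A / (2 * M).
Proof.
have m0 := den_m_gt0 hg; have M0 := den_M_gt0 hg.
have q0 := sqrt_mM_gt0; set q := Num.sqrt (m * M) in q0 *.
have q2 : q ^+ 2 = m * M by rewrite sqr_sqrtr// mulr_ge0 ?ltW.
have -> : A / (2 * M) = (1 - s) * delta / (2 * M) - mubar / (2 * q).
  by rewrite -/q; field; rewrite !gt_eqF.
have [l0|l0|l0] := ltgtP l 0.
- by have := num_modulus_ge0 hf; rewrite leNgt l0.
(* The bound on [kappabar] is squared and scaled by [l / (2 * m)]. Its radicand is positive because
   the root exceeds [kappabar >= 0]. *)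
- have := alg_kappabar_lt hx l0; rewrite -/q => hk.
  have rhs0 : 0 < m * delta * (1 - s) / (l * M) - 2 * m * mubar / (l * q).
    by rewrite -sqrtr_gt0; apply: le_lt_trans hk; exact: (alg_kappabar_ge0 hx).
  have := hk; rewrite -(@ltr_pXn2r _ 2)// ?nnegrE ?sqrtr_ge0
    ?(alg_kappabar_ge0 hx)//.
  rewrite sqr_sqrtr ?ltW// => hk2.
  have := hk2; rewrite -(ltr_pM2l (divr_gt0 l0 (mulr_gt0 (ltr0Sn R 1) m0))).
  have -> : l / (2 * m) *
      (m * delta * (1 - s) / (l * M) - 2 * m * mubar / (l * q))
    = (1 - s) * delta / (2 * M) - mubar / q.
    by field; rewrite !gt_eqF.
  have -> : l / (2 * m) * kappabar ^+ 2 = l * kappabar ^+ 2 / (2 * m) by ring.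
  have -> : mubar / q = mubar / (2 * q) + mubar / (2 * q).
    by field; rewrite gt_eqF.
  lra.
(* For [l = 0] the [kappabar] term vanishes and the claim is the bound on [mubar]. *)
- have /andP[_] := alg_mubar hx; rewrite -/q => hm.
  rewrite l0 mul0r mul0r add0r ltrBrDr.
  have -> : mubar / (2 * q) + mubar / (2 * q) = mubar / q.
    by field; rewrite gt_eqF.
  rewrite ltr_pdivrMr//; apply: lt_le_trans hm _.
  by rewrite le_eqVlt; apply/orP; left; apply/eqP; ring.
Qed.

Lemma eps_active_max n :
  exists2 i, active_set g gi eps (x n) i & gir i (x n) = gr (x n).
Proof.
have [i gE] := max_attained hg ((den_proper hg).1 (x n)).
exists i; last by rewrite /= gE.
have gfin := denominator_fin hg (feasible n).1.
rewrite /active_set /= -gE -(fineK gfin) -EFinB lee_fin lerBlDr lerDl.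
exact/ltW/(alg_eps hx).
Qed.

(** With [y = x n] and a maximizing piece, the right side of [step_inequality] keeps only inertial
    terms. Division by [gr (x n.+1)] then uses [M] for the gain and [m] for the cost. *)
Lemma ratio_decrease n :
  theta n.+1 + A / (2 * M) * `|x n.+1 - x n| ^+ 2 <= theta n + C * `|d n| ^+ 2.
Proof.
have [i Ii gE] := eps_active_max n.
have Dx := feasible n; have Dx1 := feasible n.+1.
have := step_inequality Ii Dx.
rewrite gE (ratioK hf hg Dx) -(ratioK hf hg Dx1) !subrr normr0 expr0n /=.
rewrite linear0l linear0r !mulr0 !subr0 !add0r.
have -> : x n - u n = - (kappa n *: d n) by rewrite opprD addrA subrr add0r.
rewrite normrN normrZ exprMn => hmain.
have m0 := den_m_gt0 hg; have M0 := den_M_gt0 hg; have q0 := sqrt_mM_gt0.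
have /andP[mg gM] := bounds_fine hg Dx1.
have g0 := denominator_fine_gt0 hg Dx1.
have D0 := sqr_ge0 `|d n|; have D1 := sqr_ge0 `|x n.+1 - x n|.
rewrite -(ler_pM2l g0).
have /andP[k0 kk] := alg_kappa hx n.
have h1 : l / 2 * (`|kappa n| ^+ 2 * `|d n| ^+ 2)
      + mu n / (2 * c * tau n) * `|d n| ^+ 2
    <= m * C * `|d n| ^+ 2.
  rewrite [l / 2 * (_ * _)]mulrA -mulrDl ler_wpM2r//.
  (* By the choice of [c], [m / Num.sqrt (m * M) = 1 / c]. *)
  have -> : m * C = l / 2 * kappabar ^+ 2 + mubar / (2 * c).
    have q2 : Num.sqrt (m * M) ^+ 2 = m * M.
      by rewrite sqr_sqrtr// mulr_ge0 ?ltW.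
    move: q2 q0; set q := Num.sqrt _ => q2 q0.
    have -> : m * (l * kappabar ^+ 2 / (2 * m) + mubar / (2 * q)) =
        l / 2 * kappabar ^+ 2 + mubar / (2 * M * q) * (m * M).
      by field; rewrite !gt_eqF.
    by rewrite -q2; field; rewrite !gt_eqF.
  apply: lerD.
    rewrite ler_wpM2l ?divr_ge0 ?(num_modulus_ge0 hf)// ger0_norm//.
    by rewrite ler_pXn2r// nnegrE// (alg_kappabar_ge0 hx).
  have -> : mu n / (2 * c * tau n) = mu n / tau n / (2 * c).
    by field; rewrite !gt_eqF ?tau_gt0.
  by rewrite ler_pM2r ?mu_tau// invr_gt0 mulr_gt0// young_weight_gt0.
have h2 : m * C * `|d n| ^+ 2 <= gr (x n.+1) * (C * `|d n| ^+ 2).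
  by rewrite -mulrA ler_wpM2r// mulr_ge0 ?merit_weight_ge0.
have h3 := ler_wpM2r D1 (step_coef_ge n).
have A0 : 0 <= A / (2 * M).
  exact: le_trans merit_weight_ge0 (ltW merit_weight_lt).
have h4 : gr (x n.+1) * (A / (2 * M) * `|x n.+1 - x n| ^+ 2)
    <= 2^-1 * (A * `|x n.+1 - x n| ^+ 2).
  have -> : 2^-1 * (A * `|x n.+1 - x n| ^+ 2) =
      M * (A / (2 * M) * `|x n.+1 - x n| ^+ 2).
    by field; rewrite !gt_eqF.
  by rewrite ler_wpM2r// mulr_ge0.
move: hmain h1 h2 h3 h4; rewrite /= => hmain h1 h2 h3 h4; lra.
Qed.

Local Notation F n := (theta n + C * `|d n| ^+ 2).
Local Notation gap := (A / (2 * M) - C).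

Lemma gap_gt0 : 0 < gap.
Proof. by rewrite subr_gt0 merit_weight_lt. Qed.

Lemma merit_decrease n : F n.+1 + gap * `|x n.+1 - x n| ^+ 2 <= F n.
Proof. by have := ratio_decrease n; rewrite /=; lra. Qed.

Lemma merit_ge0 n : 0 <= F n.
Proof.
rewrite addr_ge0 ?(ratio_ge0 hf hg (feasible n))//.
by rewrite mulr_ge0 ?sqr_ge0// merit_weight_ge0.
Qed.

Lemma merit_nonincreasing : nonincreasing_seq (fun n => F n).
Proof.
apply/nonincreasing_seqP => n; apply: le_trans (merit_decrease n).
by rewrite lerDl mulr_ge0 ?sqr_ge0// ltW ?gap_gt0.
Qed.

Lemma merit_cvg : cvgn (fun n => F n).
Proof.
apply: nonincreasing_is_cvgn; first exact: merit_nonincreasing.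
by exists 0 => _ [n _ <-]; exact: merit_ge0.
Qed.

Lemma step_sum_le n : gap * (\sum_(0 <= k < n) `|x k.+1 - x k| ^+ 2) <= F 0%N.
Proof.
suff : gap * (\sum_(0 <= k < n) `|x k.+1 - x k| ^+ 2) + F n <= F 0%N.
  by apply: le_trans; rewrite lerDl merit_ge0.
elim: n => [|n IH]; first by rewrite big_geq// mulr0 add0r.
rewrite big_nat_recr//= mulrDr; have := merit_decrease n; rewrite /=; lra.
Qed.

Lemma step_summable : (\sum_(0 <= n <oo) (`|x n.+1 - x n| ^+ 2)%:E < +oo)%E.
Proof.
apply: (@le_lt_trans _ _ (F 0%N / gap)%:E); last exact: ltry.
apply: lime_le.
  by apply: is_cvg_nneseries => n _ _; rewrite lee_fin sqr_ge0.
apply: nearW => n; rewrite sumEFin lee_fin ler_pdivlMr ?gap_gt0// mulrC.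
exact: step_sum_le.
Qed.

(** Squared steps are squeezed between [0] and the differences of the convergent merit sequence
    divided by [gap]. *)
Lemma step_cvg0 : (fun n => `|x n.+1 - x n|) @ \oo --> (0 : R).
Proof.
have /cvg_ex[a Fa] := merit_cvg.
have FS : (fun n => (F n - F n.+1) / gap) @ \oo --> (0 : R).
  rewrite -[X in _ --> X](mul0r gap^-1) -(subrr a).
  by apply: cvgMr_tmp; apply: cvgB => //; rewrite (cvg_shiftS (fun n => F n)).
have sq0 : (fun n => `|x n.+1 - x n| ^+ 2) @ \oo --> (0 : R).
  apply: (squeeze_cvgr (f := cst 0) (h := fun n => (F n - F n.+1) / gap)) => //.
    apply: nearW => n; rewrite sqr_ge0 /= ler_pdivlMr ?gap_gt0// mulrC.
    by have := merit_decrease n; rewrite /=; lra.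
  exact: cvg_cst.
apply/cvgrPdist_lt => e e0; near=> n.
rewrite sub0r normrN normr_id -(@ltr_pXn2r _ 2)// ?nnegrE ?(ltW e0)//.
by near: n; apply: (cvgr_lt _ sq0); rewrite exprn_gt0.
Unshelve. all: by end_near. Qed.

Lemma back_step_cvg0 : (fun n => `|d n|) @ \oo --> (0 : R).
Proof. by rewrite -cvg_shiftS; exact: step_cvg0. Qed.

Lemma ratio_cvg : cvgn (fun n => theta n).
Proof.
have /cvg_ex[a Fa] := merit_cvg; apply/cvg_ex; exists (a - C * (0 * 0)).
have -> : (fun n => theta n) = (fun n => F n - C * (`|d n| * `|d n|)).
  by apply/funext => n; rewrite -expr2 addrK.
apply: cvgB => //; apply: cvgMl_tmp; apply: cvgM; exact: back_step_cvg0.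
Qed.

(** Since [0.-1 = 0], the inertial term vanishes at the start and the initial merit value is
    [theta 0]. *)
Lemma ratio_le_start n : theta n <= theta 0%N.
Proof.
have := merit_nonincreasing (leq0n n).
rewrite /= subrr normr0 expr0n mulr0 addr0.
by apply: le_trans; rewrite lerDl mulr_ge0 ?sqr_ge0// merit_weight_ge0.
Qed.

Lemma iterates_bounded :
  bounded_set [set y | S y /\
    (fractional_objective f g y <= fractional_objective f g (x 0%N))%E] ->
  bounded_set (range x).
Proof.
apply: sub_boundedr => B hB _ [n _ <-]; apply: hB.
split; first exact: (feasible n).1.
have := ratio_le_start n; rewrite !(objectiveE hf hg (feasible _)).
by rewrite lee_fin.
Qed.

(** * Passage to the limit along a subsequence *)

Section ClusterPoint.
Context (xbar : V) (sub : nat -> nat) (T ratio_lim : R).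
Context (hsub : sub @ \oo --> \oo) (xsub : x \o sub @ \oo --> xbar).
Context (tau_lb : \forall n \near \oo, (2 * tau n)^-1 <= T).
Context (theta_lim : (fun n => theta n) @ \oo --> ratio_lim).

Lemma cluster_feasible : S xbar.
Proof.
have Sx : \forall k \near \oo, S ((x \o sub) k).
  by apply: nearW => k; exact: (feasible _).1.
exact: (@closed_cvg _ _ \oo _ (x \o sub) S hSclosed Sx _ xsub).
Qed.

(** Writing [f] as ratio times denominator yields its limit along the subsequence without continuity
    of [f]. *)
Lemma numerator_sub_cvg : fr \o (x \o sub) @ \oo --> ratio_lim * gr xbar.
Proof.
have -> : fr \o (x \o sub) = (fun k => theta (sub k) * (gr \o (x \o sub)) k).
  by apply/funext => k /=; rewrite (ratioK hf hg (feasible _)).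
apply: cvgM; first exact: (cvg_comp _ _ hsub theta_lim).
apply: (denominator_cvg hg _ cluster_feasible xsub) => n.
exact: (feasible _).1.
Qed.

Lemma cluster_dom : dom xbar /\ fr xbar <= ratio_lim * gr xbar.
Proof.
exact: (numerator_lsc_limit hf (fun k => feasible (sub k))
  cluster_feasible xsub numerator_sub_cvg).
Qed.

Lemma extrapolation_cvg : (fun k => u (sub k)) @ \oo --> xbar.
Proof.
rewrite -[X in _ --> X]addr0; apply: cvgD => //; apply: norm_cvg0.
apply: (squeeze_cvgr (f := cst 0) (h := fun k => kappabar * `|d (sub k)|)).
- apply: nearW => k /=; have /andP[k0 kk] := alg_kappa hx (sub k).
  by rewrite normr_ge0 normrZ ger0_norm// ler_wpM2r.
- exact: cvg_cst.
- rewrite -[X in _ --> X](mulr0 kappabar); apply: cvgMl_tmp.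
  exact: (cvg_comp _ _ hsub back_step_cvg0).
Qed.

Lemma limit_inequality i z : active_set g gi 0 xbar i -> dom z ->
  0 <= fr z - ratio_lim * gr xbar + T * `|z - xbar| ^+ 2
       - ratio_lim * dot (grad i xbar) (z - xbar) + l / 2 * `|z - xbar| ^+ 2.
Proof.
move=> Ii Dz; have Sb := cluster_feasible.
have xS k : S (x (sub k)) by exact: (feasible _).1.
have dC : (fun k => `|d (sub k)|) @ \oo --> (0 : R).
  exact: (cvg_comp _ _ hsub back_step_cvg0).
have thC : (fun k => theta (sub k)) @ \oo --> ratio_lim.
  exact: (cvg_comp _ _ hsub theta_lim).
have th1C : (fun k => theta (sub k).+1) @ \oo --> ratio_lim.
  have h : (fun n => theta n.+1) @ \oo --> ratio_lim.
    by rewrite (cvg_shiftS (fun n => theta n)).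
  exact: (cvg_comp _ _ hsub h).
have giC : (fun k => gir i (x (sub k))) @ \oo --> gir i xbar.
  by apply: (cvg_comp _ _ xsub); exact: (pieces_continuous hg).
have gC : (fun k => gr (x (sub k))) @ \oo --> gr xbar.
  exact: (denominator_cvg hg xS Sb xsub).
have gradC : (fun k => grad i (x (sub k))) @ \oo --> grad i xbar.
  by apply: (cvg_comp _ _ xsub); exact: (pieces_gradient_continuous hg).
have zxC : (fun k => z - x (sub k)) @ \oo --> z - xbar.
  by apply: cvgB => //; exact: cvg_cst.
have zuC : (fun k => z - u (sub k)) @ \oo --> z - xbar.
  by apply: cvgB; [exact: cvg_cst | exact: extrapolation_cvg].
have dvC : (fun k => d (sub k)) @ \oo --> 0 by apply: norm_cvg0.
have sqC (a : nat -> V) b : a @ \oo --> b ->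
    (fun k => `|a k| ^+ 2) @ \oo --> `|b| ^+ 2.
  move=> ab; rewrite expr2; under eq_cvg do rewrite expr2.
  by apply: cvgM; exact: cvg_norm.
(* [lo] and [hi] are convergent bounds for the two sides of [step_inequality]. Since [mu n / tau n]
   and [(2 * tau n)^-1] need not converge, [mubar] and [T] replace them; at the new point only
   [g <= M] is used. *)
pose lo k := - (M * `|theta (sub k).+1 - theta (sub k)|).
pose hi k := fr z - theta (sub k) * gir i (x (sub k))
  + T * `|z - x (sub k)| ^+ 2
  + mubar * `|dot (z - x (sub k)) (d (sub k))|
  - theta (sub k) * dot (grad i (x (sub k))) (z - x (sub k))
  + l / 2 * `|z - u (sub k)| ^+ 2 + mubar / (2 * c) * `|d (sub k)| ^+ 2.
have loC : lo @ \oo --> - (M * `|ratio_lim - ratio_lim|).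
  by apply: cvgN; apply: cvgMl_tmp; apply: cvg_norm; exact: cvgB.
have hiC : hi @ \oo --> fr z - ratio_lim * gir i xbar + T * `|z - xbar| ^+ 2
    + mubar * `|dot (z - xbar) 0| - ratio_lim * dot (grad i xbar) (z - xbar)
    + l / 2 * `|z - xbar| ^+ 2 + mubar / (2 * c) * `|0 : V| ^+ 2.
  apply: cvgD; last by apply: cvgMl_tmp; exact: sqC.
  apply: cvgD; last by apply: cvgMl_tmp; exact: sqC.
  apply: cvgB; last by apply: cvgM => //; exact: dot_cvg.
  apply: cvgD; last by apply: cvgMl_tmp; apply: cvg_norm; exact: dot_cvg.
  apply: cvgD; last by apply: cvgMl_tmp; exact: sqC.
  by apply: cvgB; [exact: cvg_cst | exact: cvgM].
have := ler_cvg_to loC hiC.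
rewrite (active0_fine hg Sb Ii) subrr linear0r !normr0 expr0n /= !mulr0 !addr0.
rewrite oppr0.
apply; near=> k.
(* For a piece active at [xbar], the gap between [g] and the piece tends to [0], so it eventually
   falls below [eps > 0]. *)
have Iik : active_set g gi eps (x (sub k)) i.
  apply/(active_setE hg _ _ (xS k)); rewrite lerBlDr -lerBlDl.
  near: k; apply: (cvgr_le _ (cvgB gC giC)).
  by rewrite (active0_fine hg Sb Ii) subrr (alg_eps hx).
have := step_inequality Iik Dz.
have Dn := feasible (sub k); have Dn1 := feasible (sub k).+1.
rewrite -(ratioK hf hg Dn1) -mulrBl.
have m0 := den_m_gt0 hg.
have /andP[gm gM] := bounds_fine hg Dn1.
have tau0 := tau_gt0 (sub k).
have mt := mu_tau (sub k); have mt0 : 0 <= mu (sub k) / tau (sub k).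
  by rewrite divr_ge0 ?mu_ge0// ltW.
have M0 := den_M_gt0 hg.
have A0 : 0 <= A.
  have := le_trans merit_weight_ge0 (ltW merit_weight_lt).
  by rewrite pmulr_lge0// invr_gt0 mulr_gt0.
have h1 := mulr_ge0 (le_trans A0 (step_coef_ge (sub k)))
  (sqr_ge0 `|x (sub k).+1 - x (sub k)|).
have h2 : lo k <= (theta (sub k).+1 - theta (sub k)) * gr (x (sub k).+1).
  have h : `|theta (sub k).+1 - theta (sub k)| * gr (x (sub k).+1)
      <= M * `|theta (sub k).+1 - theta (sub k)|.
    by rewrite mulrC ler_wpM2r.
  have dth : - `|theta (sub k).+1 - theta (sub k)|
      <= theta (sub k).+1 - theta (sub k) by rewrite lerNl -normrN ler_norm.
  have := ler_wpM2r (le_trans (ltW m0) gm) dth.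
  rewrite /lo; lra.
have h3 : (2 * tau (sub k))^-1 * `|z - x (sub k)| ^+ 2
    <= T * `|z - x (sub k)| ^+ 2.
  rewrite ler_wpM2r ?sqr_ge0//; near: k; exact: (hsub tau_lb).
have h4 : - (mu (sub k) / tau (sub k) * dot (z - x (sub k)) (d (sub k)))
    <= mubar * `|dot (z - x (sub k)) (d (sub k))|.
  rewrite -mulrN; apply: le_trans (_ : mu (sub k) / tau (sub k)
    * `|dot (z - x (sub k)) (d (sub k))| <= _).
    by rewrite ler_wpM2l// -normrN ler_norm.
  by rewrite ler_wpM2r.
have h5 : mu (sub k) / (2 * c * tau (sub k)) * `|d (sub k)| ^+ 2
    <= mubar / (2 * c) * `|d (sub k)| ^+ 2.
  rewrite ler_wpM2r ?sqr_ge0//.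
  have c0 := young_weight_gt0.
  have -> : mu (sub k) / (2 * c * tau (sub k)) =
      mu (sub k) / tau (sub k) / (2 * c).
    by rewrite invfM; ring.
  by rewrite ler_pM2r// invr_gt0 mulr_gt0.
move: h1 h2; rewrite /hi /= => h1 h2 h0; lra.
Unshelve. all: by end_near. Qed.

End ClusterPoint.
End Algorithm.

(** * Extraction of subsequences and lower limits *)

Lemma cluster_subsequence (R : realType) (V : normedModType R) (x : nat -> V)
    (a : V) :
  cluster (x @ \oo) a ->
  exists2 sub : nat -> nat, sub @ \oo --> \oo & x \o sub @ \oo --> a.
Proof.
move=> ca.
(* The condition [k <= n] makes the chosen indices tend to infinity; monotonicity is not asked
   for. *)
have pick k : exists n, (k <= n)%N /\ `|a - x n| < k.+1%:R^-1.
  have xk : (x @ \oo) (x @` [set n | (k <= n)%N]).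
    by exists k => // n /= kn; exists n.
  have bk : nbhs a (ball a (k.+1%:R^-1 : R)).
    by apply: nbhsx_ballx; rewrite invr_gt0.
  have [_ [[n /= kn <-]]] := ca _ _ xk bk.
  by rewrite -ball_normE /= => h; exists n.
have [sub hsub] := choice pick; exists sub.
  apply/cvgnyPge => N; near=> k.
  by apply: leq_trans (proj1 (hsub k)); near: k; exact: nbhs_infty_ge.
apply/cvgrPdist_lt => e e0; near=> k.
apply: lt_trans (proj2 (hsub k)) _; near: k.
exact: near_infty_natSinv_lt (PosNum e0).
Unshelve. all: by end_near. Qed.

(** The lower limit is the supremum of the tail infima, so one tail infimum already exceeds [b]. *)
Lemma limn_einf_near_ge (R : realType) (t : nat -> R) (a b : R) : b < a ->
  limn_einf (fun n => (t n)%:E) = a%:E -> \forall n \near \oo, b <= t n.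
Proof.
move=> ba; rewrite limn_einf_lim => ta.
have tE := cvg_lim (@ereal_hausdorff R) (@cvg_einfs_sup R (fun n => (t n)%:E)).
have : (b%:E < ereal_sup (range (einfs (fun n => (t n)%:E))))%E.
  by rewrite -tE ta lte_fin.
move=> /ereal_sup_gt[_ [N _ <-]] bN; exists N => // n /= Nn.
rewrite -lee_fin; apply: le_trans (ltW bN) _.
by apply: ereal_inf_lbound; exists n.
Qed.

(** * Convergence of the ratios and stationarity of cluster points *)

Theorem theorem6p1 (R : realType) (V : normedModType R)
  (dot : {dot V for @idfun R}) (hV : finite_dimensional_hilbert dot)
  (S : set V) (hS0 : S !=set0) (hSclosed : closed S)
  (hSconvex : convex_set S)
  (f g : V -> \bar R) (fs : V -> R^o) (fn : V -> \bar R)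
  (p : nat) (gi : 'I_p -> V -> \bar R) (l beta m M : R)
  (hf : numerator_assumption dot S f fs fn l)
  (hg : denominator_assumption dot S f g gi beta m M)
  (delta eps zeta mubar kappabar : R) (tau kappa mu : nat -> R)
  (w : nat -> 'I_p -> V) (ihat : nat -> 'I_p) (x : nat -> V)
  (hx : extrapolated_proximal_subgradient dot S f g fs fn gi l beta m M
          delta eps zeta mubar kappabar tau kappa mu w ihat x)
  (hbounded : bounded_set
     [set y | S y /\ (fractional_objective f g y <= fractional_objective f g (x 0%N))%E]) :
  let theta : nat -> R := fun n => fine (fractional_objective f g (x n)) in
  let F : nat -> R := fun n =>
    theta n + (l * kappabar ^+ 2 / (2 * m) + mubar / (2 * Num.sqrt (m * M)))
              * `|x n - x n.-1| ^+ 2 in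
  [/\
    (* (i) *)
    [/\ forall n, (S `&` edom f) (x n),
        nonincreasing_seq F,
        cvgn F
      & cvgn theta],
    (* (ii) *)
    [/\ bounded_set (range x),
        (fun n => `|x n.+1 - x n|) @ \oo --> (0 : R)
      & (\sum_(0 <= n <oo) (`|x n.+1 - x n| ^+ 2)%:E < +oo)%E]
    (* (iii) *)
    & forall taubar : R, 0 < taubar ->
      limn_einf (fun n => (tau n)%:E) = taubar%:E ->
      forall xbar : V, cluster (x @ \oo) xbar ->
      [/\ (S `&` edom f) xbar,
          theta @ \oo --> fine (fractional_objective f g xbar),
          [set fine (fractional_objective f g xbar) *: gradient dot (fine \o gi i) xbar
             | i in active_set g gi 0 xbar] `<=`
            limiting_subdifferential dot (fun y => f y + indicator S y)%E xbar
        & weakly_convex S f -> strong_lifted_stationary dot f g S xbar]].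
Proof.
move=> theta F; split.
- split.
  + exact: (feasible hf hx).
  + exact: (merit_nonincreasing hV hSconvex hf hg hx).
  + exact: (merit_cvg hV hSconvex hf hg hx).
  + exact: (ratio_cvg hV hSconvex hf hg hx).
- split.
  + exact: (iterates_bounded hV hSconvex hf hg hx).
  + exact: (step_cvg0 hV hSconvex hf hg hx).
  + exact: (step_summable hV hSconvex hf hg hx).
move=> taubar taubar0 tau_inf xbar /cluster_subsequence[sub hsub xsub].
(* The threshold [taubar / 2] turns the bound on [(2 * tau n)^-1] into [taubar^-1]. *)
have half : taubar / 2 < taubar by lra.
have tau_lb : \forall n \near \oo, (2 * tau n)^-1 <= taubar^-1.
  apply: filterS (limn_einf_near_ge half tau_inf) => n htau.
  by rewrite lef_pV2 ?posrE ?mulr_gt0 ?(tau_gt0 hx)//; lra.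
have /cvg_ex[a thetaC] := ratio_cvg hV hSconvex hf hg hx.
have [Db fle] := cluster_dom hSclosed hf hg hx hsub xsub thetaC.
have ineq i z := @limit_inequality R V dot hV S hSclosed hSconvex f g fs fn p
  gi l beta m M hf hg delta eps zeta mubar kappabar tau kappa mu w ihat x hx
  xbar sub taubar^-1 a hsub xsub tau_lb thetaC i z.
have [j gj] := max_attained hg ((den_proper hg).1 xbar).
have Ij : active_set g gi 0 xbar j by rewrite /active_set /= sube0 gj.
(* Lower semicontinuity gave one inequality; the competitor [xbar] gives the other. *)
have fE : fine (f xbar) = a * fine (g xbar).
  have := ineq j xbar Ij Db; rewrite subrr normr0 linear0r expr0n /=.
  by move: fle => /=; move=> h1 h2; apply/eqP; rewrite eq_le h1 /=; lra.
have g0 := denominator_fine_gt0 hg Db.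
have aE : a = fine (fractional_objective f g xbar).
  by rewrite (objectiveE hf hg Db) /= fE mulfK// gt_eqF.
have a0 : 0 <= a by rewrite aE (ratio_ge0 hf hg Db).
have K0 : 0 <= taubar^-1 + l / 2.
  rewrite addr_ge0 ?invr_ge0 ?(ltW taubar0)//.
  by rewrite divr_ge0// (num_modulus_ge0 hf).
split.
- exact: Db.
- by rewrite -aE.
- move=> _ [i Ii <-]; rewrite -aE.
  apply: (limiting_of_quadratic_minorant hf Db K0) => y Dy.
  by have := ineq i y Ii Dy; rewrite dotZl /= fE; lra.
- move=> _ _ [v gv <-]; exists (a *: v); last first.
    by rewrite scalerA /= fE mulrC.
  apply: (limiting_of_quadratic_minorant hf Db K0) => y Dy.
  rewrite dotZl; apply/ler_addgt0Pr => e e0.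
  (* The tolerance is multiplied by [a] below; the [+ 1] covers [a = 0]. *)
  have e1 : 0 < e / (a + 1) by rewrite divr_gt0// ltr_wpDl.
  (* The active piece depends on the direction [y - xbar], which is harmless because the constant in
     [ineq] is the same for all pieces. *)
  have [i Ii] := limiting_max_direction hV hg (y - xbar) Db.1 e1 gv.
  move=> /(ler_wpM2l a0); rewrite mulrDr.
  have : a * (e / (a + 1)) <= e.
    by rewrite mulrCA ger_pMr// ler_pdivrMr ?ltr_wpDl// mul1r lerDl.
  by have := ineq i y Ii Dy; rewrite /= fE; lra.
Qed.
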